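(* Let $\mathcal{D}$ be an $[n,k,d]_q$ Reed-Solomon code with $k\le 2$, and let $M(\mathcal{D})$ be the binary matrix obtained from $\mathcal{D}$ by the Kautz-Singleton construction. Then the Tanner graph corresponding to $M(\mathcal{D})$ is free of $4$-cycles, and so has girth at least $6$.
   Context: An $[n,k,d]_q$ code is a $k$-dimensional linear subspace of $\mathbb{F}_q^n$ with minimum distance $d$. An $[n,k,d]_q$ Reed-Solomon code ($1\le k\le n\le q$) is the set of all vectors $(p(\beta_1),\dots,p(\beta_n))$, where $\beta_1,\dots,\beta_n$ are fixed distinct elements of $\mathbb{F}_q$ and $p$ ranges over the polynomials over $\mathbb{F}_q$ of degree at most $k-1$. Kautz-Singleton construction: order the elements of $\mathbb{F}_q$ as $\alpha_1,\dots,\alpha_q$ and let $\mathbf{e}_i$ be the $i$th standard basis column vector of length $q$. The binary matrix $M(\mathcal{D})$ is formed by listing all codewords of $\mathcal{D}$ as the columns of a matrix and then replacing each symbol $\alpha_i$ with the column vector $\mathbf{e}_i$; thus $M(\mathcal{D})$ is $nq\times q^k$. The Tanner graph of a binary matrix $H$ is the bipartite graph with one vertex for each column and one vertex for each row, where a column vertex and a row vertex are adjacent if and only if the corresponding entry of $H$ is nonzero. The girth of a graph is the length of a shortest cycle ($\infty$ if there is none). *)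

(* Defs.v *)
From mathcomp Require Import all_boot all_order all_algebra.
Set Implicit Arguments.
Unset Strict Implicit.
Unset Printing Implicit Defensive.
Import GRing.Theory.
Local Open Scope ring_scope.

Definition hamming_dist (F : finFieldType) (n : nat) (u v : 'rV[F]_n) : nat :=
  #|[set i : 'I_n | u 0 i != v 0 i]|.

Definition min_distance (F : finFieldType) (n : nat)
    (D : {vspace 'rV[F]_n}) (d : nat) : Prop :=
  (exists u v, [/\ u \in D, v \in D, u != v & hamming_dist u v = d]) /\
  (forall u v, u \in D -> v \in D -> u != v -> (d <= hamming_dist u v)%N).

Definition linear_code (F : finFieldType) (n k d : nat)
    (D : {vspace 'rV[F]_n}) : Prop :=
  \dim D = k /\ min_distance D d.

(* [size p <= k] says that p has degree at most k - 1 (or is 0). *)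
Definition reed_solomon (F : finFieldType) (n k d : nat)
    (D : {vspace 'rV[F]_n}) : Prop :=
  [/\ (1 <= k)%N, (k <= n)%N, (n <= #|F|)%N, linear_code k d D &
      exists beta : 'I_n -> F, injective beta /\
        forall c : 'rV[F]_n,
          c \in D <->
          exists p : {poly F}, (size p <= k)%N /\ c = \row_i p.[beta i]].

Definition lists_codewords (F : finFieldType) (n N : nat)
    (w : 'I_N -> 'rV[F]_n) (D : {vspace 'rV[F]_n}) : Prop :=
  injective w /\ forall c : 'rV[F]_n, c \in D <-> exists j, w j = c.

(* If alpha enumerates F without repetition, this is e_i for x = alpha i. *)
Definition symbol_col (F : finFieldType) (q : nat) (alpha : 'I_q -> F) (x : F) :
    'cV['F_2]_q :=
  \col_s (x == alpha s)%:R.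

(* [mxvec] is row-major, so column j stacks the n blocks of length q that
   replace the symbols of w j. *)
Definition kautz_singleton (F : finFieldType) (n q N : nat)
    (alpha : 'I_q -> F) (w : 'I_N -> 'rV[F]_n) : 'M['F_2]_(n * q, N) :=
  \matrix_(r, j)
    mxvec (\matrix_(i < n, s < q) symbol_col alpha (w j 0 i) s 0) 0 r.

(* [inl] vertices are the columns of H, [inr] vertices are its rows. *)
Definition tanner (m N : nat) (H : 'M['F_2]_(m, N)) : rel ('I_N + 'I_m) :=
  fun x y =>
    match x, y with
    | inl j, inr r | inr r, inl j => H r j != 0
    | _, _ => false
    end.

Definition has_cycle (T : finType) (e : rel T) (l : nat) : bool :=
  (2 < l)%N && [exists t : l.-tuple T, ucycleb e t].

(* [None] is infinity. The vertices of a cycle are distinct, so no cycle is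
   longer than #|T|, and the first length in the increasing list is the least. *)
Definition girth (T : finType) (e : rel T) : option nat :=
  ohead [seq l <- iota 0 #|T|.+1 | has_cycle e l].

Definition girth_at_least (T : finType) (e : rel T) (g : nat) : Prop :=
  if girth e is Some l then (g <= l)%N else True.

(* Main.v *)
Require Import Defs.
From mathcomp Require Import all_boot all_order all_algebra.
Local Open Scope ring_scope.

(** A 4-cycle consists of two codewords and two rows [(i1, s1)], [(i2, s2)] on
    which both codewords have entry 1, so the codewords agree at [i1] and [i2].
    These positions differ, since a block of rows has a single 1 in each column.
    Two polynomials of degree at most 1 that agree at two points are equal.
    Odd cycles do not exist in a bipartite graph. *)

Lemma kautz_singletonE (F : finFieldType) (n q N : nat) (alpha : 'I_q -> F)
    (w : 'I_N -> 'rV[F]_n) (i : 'I_n) (s : 'I_q) (j : 'I_N) :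
  (kautz_singleton alpha w (mxvec_index i s) j != 0) = (w j 0 i == alpha s).
Proof. by rewrite mxE mxvecE !mxE; case: (_ == alpha s). Qed.

(** The difference of the two message polynomials has size at most [k], yet it vanishes at the
    [#|A| >= k] distinct points [beta i] with [i] in [A], so it is zero. *)
Lemma reed_solomon_eq (F : finFieldType) (n k d : nat) (D : {vspace 'rV[F]_n})
    (u v : 'rV[F]_n) (A : {set 'I_n}) :
  reed_solomon k d D -> u \in D -> v \in D -> (k <= #|A|)%N ->
  {in A, forall i, u 0 i = v 0 i} -> u = v.
Proof.
case=> _ _ _ _ [beta [beta_inj memD]].
move=> /memD[p [sz_p ->]] /memD[p' [sz_p' ->]] leA eqA.
suff: p - p' == 0 by rewrite GRing.subr_eq0 => /eqP ->.
apply/negPn/negP => nz.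
have: (size [seq beta i | i <- enum A] < size (p - p')%R)%N.
  apply: max_poly_roots => //; last by rewrite map_inj_uniq ?enum_uniq.
  apply/allP => x /mapP[i]; rewrite mem_enum => /eqA; rewrite !mxE => eqi ->.
  by rewrite rootE !hornerE eqi GRing.subrr.
rewrite size_map -cardE ltnNge; case/negP; apply: leq_trans leA.
by rewrite (leq_trans (size_polyD _ _)) // size_polyN geq_max sz_p.
Qed.

(** Each edge switches between columns and rows, and a closed walk ends on the side where it
    began. *)
Lemma tanner_cycle_even (m N : nat) (H : 'M['F_2]_(m, N)) (l : nat) :
  has_cycle (tanner H) l -> ~~ odd l.
Proof.
have side x p : path (tanner H) x p ->
    is_inl (last x p) = is_inl x (+) odd (size p).
  elim: p x => [|y p IHp] x /=; first by rewrite addbF.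
  by case/andP=> exy /IHp ->; case: x y exy => [?|?] [?|?] //=; case: odd.
case/andP=> _ /existsP[t /andP[cyc _]]; rewrite -(size_tuple t).
case: (tval t) cyc => // x p /side; rewrite last_rcons size_rcons /=.
by case: is_inl (odd _) => [] [].
Qed.

Lemma tanner_4cycle_free (m N : nat) (H : 'M['F_2]_(m, N)) :
  (forall j1 j2 r1 r2, H r1 j1 != 0 -> H r1 j2 != 0 -> H r2 j1 != 0 ->
     H r2 j2 != 0 -> j1 != j2 -> r1 = r2) ->
  ~~ has_cycle (tanner H) 4.
Proof.
move=> no_rect; apply/negP => /andP[_ /existsP[[t /= /eqP]]].
case: t => [|a [|b [|c [|d []]]]] //= _ /andP[].
(* Only the two alternating patterns survive: the cycle starts at a column or at a row. *)
case: a b c d => [j1|r1] [j2|r2] [j3|r3] [j4|r4] //=; rewrite ?andbF //.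
- rewrite andbT => /and4P[h1 h2 h3 h4]; rewrite !inE /= !andbT => /andP[n1 n2].
  have ne : j1 != j3 by apply: contraNneq n1 => ->; rewrite eqxx.
  by rewrite (no_rect j1 j3 r2 r4) ?eqxx // in n2.
- rewrite andbT => /and4P[h1 h2 h3 h4]; rewrite !inE /= !andbT => /andP[n1 n2].
  have ne : j2 != j4 by apply: contraNneq n2 => ->; rewrite eqxx.
  by rewrite (no_rect j2 j4 r1 r3) ?eqxx // in n1.
Qed.

Lemma tanner_girth_ge6 (m N : nat) (H : 'M['F_2]_(m, N)) :
  ~~ has_cycle (tanner H) 4 -> girth_at_least (tanner H) 6.
Proof.
move=> no4; rewrite /girth_at_least /girth.
case E: [seq _ <- _ | _] => [//|l s] /=.
have: l \in l :: s by rewrite mem_head.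
rewrite -E mem_filter => /andP[cyc _].
have /tanner_cycle_even := cyc; case/andP: (cyc) => gt2 _.
(* Parity excludes lengths 3 and 5, and [no4] excludes 4. *)
by case: l {E} cyc gt2 => [|[|[|[|[|[|l]]]]]] //; rewrite (negPf no4).
Qed.

Theorem proposition3p22 (F : finFieldType) (q n k d : nat)
    (D : {vspace 'rV[F]_n}) (alpha : 'I_q -> F) (w : 'I_(q ^ k) -> 'rV[F]_n) :
  #|F| = q ->
  reed_solomon k d D ->
  (k <= 2)%N ->
  bijective alpha ->
  lists_codewords w D ->
  ~~ has_cycle (tanner (kautz_singleton alpha w)) 4 /\
  girth_at_least (tanner (kautz_singleton alpha w)) 6.
Proof.
move=> _ RS k_le2 /bij_inj alpha_inj [w_inj memD].
suff no4 : ~~ has_cycle (tanner (kautz_singleton alpha w)) 4.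
  by split=> //; apply: tanner_girth_ge6.
apply: tanner_4cycle_free => j1 j2 r1 r2.
case/mxvec_indexP: r1 => i1 s1; case/mxvec_indexP: r2 => i2 s2.
rewrite !kautz_singletonE => /eqP e11 /eqP e12 /eqP e21 /eqP e22 ne_j.
have [eq_i|ne_i] := eqVneq i1 i2.
  (* Within one block, [alpha s1] and [alpha s2] are the same symbol of [w j1], so the two rows
     coincide. *)
  by move: e21; rewrite -eq_i e11 => /alpha_inj ->.
(* Two distinct positions of agreement suffice because [k <= 2]. *)
case/eqP: ne_j; apply: w_inj; apply: (reed_solomon_eq _ _ _ _ _ _ _ [set i1; i2] RS).
- by apply/memD; exists j1.
- by apply/memD; exists j2.
- by rewrite cards2 ne_i.
- by move=> i /set2P[] ->; rewrite ?e11 ?e12 ?e21 ?e22.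
Qed.
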